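(* Let $v \geq 7$ and $\ell \geq 3$ be integers. If a Steiner triple system of order $v$ has an $\ell$-good sequencing, then $\ell \leq (v+2)/3$.
   Context: A Steiner triple system of order $v$ (an STS$(v)$) is a pair $(X,\mathcal{B})$ where $X$ is a set of $v$ points and $\mathcal{B}$ is a set of 3-subsets of $X$ (blocks) such that every pair of distinct points lies in exactly one block. For an integer $\ell \geq 3$, an $\ell$-good sequencing of $(X,\mathcal{B})$ is a permutation $[x_1\, x_2\, \cdots\, x_v]$ of $X$ such that no $\ell$ consecutive points $x_j, x_{j+1},\dots,x_{j+\ell-1}$ of the permutation contain a block of $\mathcal{B}$.
   Formalization: The formal theorem also assumes ℓ ≤ v; for ℓ > v there are no ℓ consecutive points, so every permutation is vacuously ℓ-good and the bound fails (e.g. v = 7, ℓ = 8). *)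

(* Defs.v *)
From mathcomp Require Import all_boot all_order all_algebra.
Set Implicit Arguments.
Unset Strict Implicit.
Unset Printing Implicit Defensive.

(* The point set is the whole finite type X. *)
Definition steiner_triple_system (v : nat) (X : finType) (B : {set {set X}})
  : Prop :=
  [/\ #|X| = v,
      forall b : {set X}, b \in B -> #|b| = 3
    & forall x y : X, x != y ->
        exists! b : {set X}, [/\ b \in B, x \in b & y \in b]].

(* Positions are numbered from 0, so [take l (drop j s)] lists the l consecutive
   points in positions j, ..., j + l - 1; the guard on j ensures that it is a
   full window. For l > v there is no window and the condition is vacuous. *)
Definition good_sequencing (l : nat) (X : finType) (B : {set {set X}})
    (s : seq X) : Prop :=
  perm_eq s (enum X) /\
  (forall j : nat, j + l <= size s ->
     forall b : {set X}, b \in B -> ~~ (b \subset take l (drop j s))).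

(* Main.v *)
(* Cut the sequencing into two halves and give a pair of points the weight -1 if
   it meets both halves, and otherwise 2 or -4 according to whether its
   positions are less than l apart or not. A block has span at least l, so if it
   lies in one half it contains a pair of weight -4, and if it does not it
   contains exactly one pair inside a half; either way its total weight is at
   most 0. Every pair lies in exactly one block, so the weights of all pairs add
   up to at most 0. This sum is explicit, and it is positive if 3 l > v + 2. *)
Require Import Defs.
From mathcomp Require Import all_boot all_order all_algebra.
From mathcomp Require Import zify lra.
Import Order.TTheory GRing.Theory Num.Theory.

Definition pair_weight (a l i j : nat) : int :=
  if (i < a) != (j < a) then (- 1)%R
  else if i + l <= j then (- 4)%R else 2%R.

Lemma pair_weight_triple (a l i j k : nat) :
  i < j -> j < k -> i + l <= k ->
  (pair_weight a l i j + pair_weight a l i k + pair_weight a l j k <= 0)%R.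
Proof.
rewrite /pair_weight => lt_ij lt_jk le_ik.
case: (ltnP i a) => ia; case: (ltnP j a) => ja; case: (ltnP k a) => ka //=;
  rewrite ?le_ik; do ?case: ifP => _; lia.
Qed.

(** The term [minn n (j.+1 - l)] counts the [i < n] with [i + l <= j]; each such [i] lowers the
    weight from 2 to -4. The bound [n] is kept apart from [j] so that induction on [n] goes
    through. *)
Lemma sum_pair_weight_left (a l j n : nat) : j < a -> n <= j ->
  (\sum_(i < n) pair_weight a l i j = 2 * n%:Z - 6 * (minn n (j.+1 - l))%:Z)%R.
Proof.
move=> ja; elim: n => [|n IHn] nj; first by rewrite big_ord0 min0n.
rewrite big_ord_recr /= IHn ?(ltnW nj) // /pair_weight.
by do ?case: ifP => ?; lia.
Qed.

(** The same count restricted to [a <= i], while each position before the cut contributes -1. *)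
Lemma sum_pair_weight_right (a l j n : nat) : a <= j -> n <= j ->
  (\sum_(i < n) pair_weight a l i j
   = 2 * (n - a)%:Z - 6 * (minn (n - a) (j.+1 - l - a))%:Z - (minn n a)%:Z)%R.
Proof.
move=> aj; elim: n => [|n IHn] nj; first by rewrite big_ord0 !sub0n !min0n.
rewrite big_ord_recr /= IHn ?(ltnW nj) // /pair_weight.
by do ?case: ifP => ?; lia.
Qed.

(** A half of size [a] has [a * (a - 1) / 2] pairs, each of weight 2 except for the
    [(a - l) * (a - l + 1) / 2] pairs at distance at least [l], which lose 6. Truncated subtraction
    makes this last count 0 when [a < l]. *)
Lemma sum_pair_weight (a b l : nat) : 0 < l ->
  (\sum_(j < a + b) \sum_(i < j) pair_weight a l i j
   = a%:Z * (a%:Z - 1) - 3 * (a - l)%:Z * ((a - l)%:Z + 1)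
   + b%:Z * (b%:Z - 1) - 3 * (b - l)%:Z * ((b - l)%:Z + 1) - a%:Z * b%:Z)%R.
Proof.
move=> l0; elim: b => [|b IHb].
  rewrite addn0 sub0n.
  have: forall n, n <= a -> (\sum_(j < n) \sum_(i < j) pair_weight a l i j
    = n%:Z * (n%:Z - 1) - 3 * (n - l)%:Z * ((n - l)%:Z + 1))%R.
    elim=> [|n IHn] na; first by rewrite big_ord0 sub0n.
    rewrite big_ord_recr /= IHn ?(ltnW na) // sum_pair_weight_left //.
    have ->: minn n (n.+1 - l) = n.+1 - l by lia.
    case: (leqP l n) => ln; first by rewrite subSn //; lia.
    have ->: n - l = 0 by lia.
    have ->: n.+1 - l = 0 by lia.
    lia.
  by move=> /(_ a (leqnn a)) ->; lia.
rewrite addnS big_ord_recr /= IHb sum_pair_weight_right ?leq_addr //.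
have ->: minn (a + b - a) ((a + b).+1 - l - a) = b.+1 - l by lia.
have ->: minn (a + b) a = a by lia.
rewrite addKn.
case: (leqP l b) => lb; first by rewrite subSn //; lia.
have ->: b - l = 0 by lia.
have ->: b.+1 - l = 0 by lia.
lia.
Qed.

(** After exchanging sums, each related pair is summed over the blocks containing it; its points are
    distinct by irreflexivity, so there is exactly one. For [r y x] meaning that [y] precedes [x],
    every unordered pair is counted once. *)
Lemma sum_over_blocks (v : nat) (X : finType) (B : {set {set X}})
    (r : rel X) (w : X -> X -> int) :
  steiner_triple_system v B -> irreflexive r ->
  (\sum_x \sum_(y | r y x) w y x
   = \sum_(b in B) \sum_(x in b) \sum_(y in b | r y x) w y x)%R.
Proof.
move=> [_ _ hB] irr.
rewrite [RHS](exchange_big_dep xpredT) //=; apply: eq_bigr => x _.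
rewrite [RHS](exchange_big_dep (fun y => r y x)) /=; last by move=> b y _ /andP[].
apply: eq_bigr => y ryx.
have /hB[b [[bB xb yb] b_uniq]] : x != y.
  by apply: contraTneq ryx => ->; rewrite irr.
rewrite (big_pred1 b) // => c; rewrite ryx andbT.
apply/idP/eqP => [/andP[/andP[cB xc] yc]|->]; last by rewrite bB xb yb.
by apply/esym/b_uniq.
Qed.

Lemma card3_sorted (X : finType) (f : X -> nat) (b : {set X}) :
  injective f -> #|b| = 3 ->
  exists x y z, [/\ b = [set x; y; z], f x < f y & f y < f z].
Proof.
move=> f_inj b3.
have: size (sort (relpre f leq) (enum b)) = 3 by rewrite size_sort -cardE.
have: sorted (relpre f leq) (sort (relpre f leq) (enum b)).
  by apply: sort_sorted => x y; apply: leq_total.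
have: uniq (sort (relpre f leq) (enum b)) by rewrite sort_uniq enum_uniq.
have: sort (relpre f leq) (enum b) =i b by move=> x; rewrite mem_sort mem_enum.
case: sort => [|x [|y [|z []]]] //= mem_b.
rewrite !inE negb_or !andbT => /andP[/andP[xy xz] yz] /andP[le_xy le_yz] _.
exists x, y, z; rewrite !ltn_neqAle le_xy le_yz !(inj_eq f_inj) xy yz; split=> //.
by apply/setP=> u; rewrite -mem_b !inE orbA.
Qed.

Lemma good_sequencing_span (l : nat) (X : finType) (B : {set {set X}})
    (s : seq X) (b : {set X}) (m : nat) :
  good_sequencing l B s -> l <= size s -> b \in B ->
  exists2 x, x \in b & ~~ (m <= index x s < m + l).
Proof.
move=> [s_perm s_good] ls bB.
have mem_s x : x \in s by rewrite (perm_mem s_perm) mem_enum.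
(* A window from [m] may run past the end, so it is moved back to the last full one, which still
   covers every point from position [m] on. *)
pose j := minn m (size s - l).
have /s_good/(_ b bB)/subsetPn[x xb xNw]: j + l <= size s by rewrite /j; lia.
exists x => //; apply: contra xNw => /andP[mx xm].
have xs : index x s < size s by rewrite index_mem.
have [jx xj] : j <= index x s /\ index x s < j + l by rewrite /j; lia.
have <- : nth x (take l (drop j s)) (index x s - j) = x.
  rewrite nth_take; last by lia.
  by rewrite nth_drop subnKC // nth_index.
apply: mem_nth; rewrite size_take size_drop; case: ifP => _; first by lia.
by rewrite ltn_sub2r //; apply: leq_ltn_trans xs.
Qed.

Lemma sum_index (X : finType) (s : seq X) (F : nat -> int) (P : pred nat) :
  perm_eq s (enum X) ->
  (\sum_(x | P (index x s)) F (index x s) = \sum_(i < size s | P i) F i)%R.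
Proof.
move=> s_perm.
transitivity (\sum_(x <- s | P (index x s)) F (index x s))%R.
  by rewrite (perm_big _ s_perm) big_enum_cond.
have s_uniq : uniq s by rewrite (perm_uniq s_perm) enum_uniq.
case: s s_uniq {s_perm} => [|x0 s'] s_uniq; first by rewrite big_nil big_ord0.
rewrite (big_nth x0) big_mkord.
by apply: eq_big => [i|i _]; rewrite index_uniq.
Qed.

Theorem theorem2p1 (v l : nat) (X : finType) (B : {set {set X}})
    (hv : 7 <= v) (hl : 3 <= l) (hlv : l <= v)
    (hB : steiner_triple_system v B)
    (hs : exists s : seq X, good_sequencing l B s) :
  (l%:R <= (v%:R + 2) / 3 :> rat)%R.
Proof.
suff h: 3 * l <= v + 2.
  have : ((3 * l)%:R <= (v + 2)%:R :> rat)%R by rewrite ler_nat.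
  by rewrite natrM natrD; lra.
rewrite leqNgt; apply/negP => lv.
have [s s_good] := hs; have [s_perm _] := s_good.
have [cardX card_b _] := hB.
have size_s : size s = v by rewrite (perm_size s_perm) -cardE.
have mem_s x : x \in s by rewrite (perm_mem s_perm) mem_enum.
pose f x := index x s.
have f_inj : injective f by move=> x y; apply: index_inj.
pose a := v./2; pose b := v - a.
have vab : v = a + b by rewrite /b /a; lia.
pose W x y := pair_weight a l (f x) (f y).
have : (\sum_x \sum_(y | (f y < f x)%N) W y x <= 0)%R.
  rewrite (@sum_over_blocks v X B (fun y x => f y < f x) W hB); last first.
    by move=> x; rewrite ltnn.
  apply: sumr_le0 => c cB.
  have [x [y [z [def_c xy yz]]]] := card3_sorted _ f c f_inj (card_b _ cB).
  (* The window starting at [x] misses a point of the block; it is [y] or [z], and [z] comes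
     last. *)
  have xz : f x + l <= f z.
    have ls : l <= size s by rewrite size_s.
    have [u] := good_sequencing_span _ _ _ _ c (f x) s_good ls cB.
    by rewrite def_c !inE -orbA => /or3P[] /eqP->; rewrite -/(f _); lia.
  have neq t u : f t < f u -> (t == u) = false.
    by move=> tu; apply: contraTF tu => /eqP->; rewrite ltnn.
  have sum_c F : (\sum_(t in c) F t = F x + F y + F z :> int)%R.
    have [[xy' yz'] xz'] := (neq x y xy, neq y z yz, neq x z (ltn_trans xy yz)).
    rewrite def_c setUC !big_setU1 ?inE ?(eq_sym z) ?xy' ?xz' ?yz' // big_set1 /=.
    by rewrite addrC.
  (* Of the nine ordered pairs from the block, only the three increasing ones survive. *)
  under eq_bigr do rewrite big_mkcondr sum_c.
  rewrite sum_c !ltnn xy yz (ltn_trans xy yz) !ifN -?leqNgt; try lia.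
  by rewrite !add0r !addr0 addrA; apply: pair_weight_triple => //; lia.
have -> : (\sum_x \sum_(y | (f y < f x)%N) W y x
           = \sum_(j < v) \sum_(i < j) pair_weight a l i j)%R.
  rewrite -size_s.
  rewrite -(sum_index X s (fun j => \sum_(i < j) pair_weight a l i j)%R xpredT s_perm).
  apply: eq_bigr => x _.
  rewrite (sum_index X s (fun i => pair_weight a l i (f x)) (fun i => i < f x) s_perm).
  by rewrite -(big_ord_widen _ (fun i => pair_weight a l i (f x))) // index_size.
rewrite vab sum_pair_weight; last by lia.
(* Here [b] is [a] or [a + 1], and [3 * l >= a + b + 3]. By these two bounds the sum is at least
   [(a^2 - 4 a + 2) / 3] if [b = a], where [v >= 7] forces [a >= 4], and at least
   [(a^2 - a + 2) / 3] if [b = a + 1]; both are positive. *)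
have: 3 * (a - l) <= a - 3 by lia.
have: 3 * (b - l) <= a - 1 by lia.
nia.
Qed.
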